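(* Consider the distributed fair $k$-center algorithm described below on a finite metric space $(X,d)$ with $|X|=n$, group assignment $g:X\to\{1,\dots,m\}$, capacities $k_1,\dots,k_m$ with $k=\sum_jk_j$, and $\tau\ge\mathrm{OPT}$, where $X$ is split equally among $\ell$ processors ($|X_i|=n/\ell\ge k+1$). Assuming each distance evaluation and group lookup takes constant time, the running time of the algorithm (the maximum running time of a processor plus the running time of the coordinator) is $O(kn/\ell+mk^2\ell)$. Choosing $\ell=\Theta(\sqrt{n/(mk)})$, this is $O(m^{1/2}k^{3/2}n^{1/2})$. Algorithm. Each processor $i$: picks $p^i_1\in X_i$ arbitrarily; for $j=2,\dots,k+1$ sets $p^i_j\in\arg\max_{p\in X_i}\min_{1\le j'<j}d(p,p^i_{j'})$; $P_i=\{p^i_1,\dots,p^i_k\}$; $r_i=\min_{1\le j'\le k}d(p^i_{k+1},p^i_{j'})/2$; for each $p\in P_i$ builds $L(p)$ by initializing $L(p)=\{p\}$ and in one scan of $X_i$ adding $x$ whenever $d(p,x)\le2r_i$ and $L(p)$ has no point of group $g(x)$; sends $(P_i,L_i)$ with $L_i=\bigcup_{p\in P_i}L(p)$. The coordinator: with $X'=\bigcup_iP_i$ and $L=\bigcup_iL_i$, computes $P$ by one scan of $X'$ (start with the first point, add $q$ whenever $\min_{p\in P}d(p,q)>10\tau$); for each $q\in P$ builds $N(q)$ by initializing $N(q)=\{q\}$ and in one scan of $L$ adding $x$ whenever $d(q,x)\le5\tau$ and $N(q)$ has no point of group $g(x)$; finally computes a feasible subset of $\bigcup_{q\in P}N(q)$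 intersecting as many $N(q)$ as possible, by building the flow network with a source joined by unit-capacity arcs to one node per set $N(q)$, an arc from the node of $N(q)$ to a node for group $j$ whenever $N(q)$ contains a point of group $j$, and an arc of capacity $k_j$ from group node $j$ to a sink, computing an integral maximum flow with the Ford–Fulkerson algorithm, and selecting, for every arc from $N(q)$ to group $j$ carrying flow, the point of $N(q)$ of group $j$.
   Context: For nonempty $A,B\subseteq X$, the clustering cost of $A$ for $B$ is $\max_{b\in B}\min_{a\in A}d(a,b)$. A set $S\subseteq X$ is feasible if for every group $j$ it contains at most $k_j$ points of group $j$. $\mathrm{OPT}$ is the minimum over feasible $S$ of the clustering cost of $S$ for $X$. *)

(* Defs.v *)
From HB Require Import structures.
From mathcomp Require Import all_boot all_order all_algebra.
From mathcomp Require Import reals constructive_ereal exp.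

Set Implicit Arguments.
Unset Strict Implicit.
Unset Printing Implicit Defensive.

Import Order.TTheory GRing.Theory Num.Theory.
Local Open Scope ring_scope.

(** * Cost model

  Programs of a unit-cost RAM are written in the delay monad: each [Later] is
  one time step, and the running time of a terminating program is the number of
  [Later]s in front of its result.  A program that does not terminate is an
  infinite sequence of [Later]s and has no running time.

  Everything that inspects or produces data is charged:
  - [op v] evaluates one primitive operation (a distance evaluation, a group
    lookup, an arithmetic operation or a comparison, a read or a write of an
    array cell) in one step;
  - every iteration of a loop or of a recursion costs one step, on top of the
    cost of its body, which pays for the control flow and for the bounded
    amount of pairing and consing done in that iteration.
  Programs below are built from these combinators only.  Arrays are sequences
  used single-threadedly: an updated array replaces the old one. *)

CoInductive delay (A : Type) : Type :=
  | Now of A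
  | Later of delay A.

Inductive takes (A : Type) : delay A -> A -> nat -> Prop :=
  | takes_now a : takes (Now a) a 0
  | takes_later p a t : takes p a t -> takes (Later p) a t.+1.

Lemma takes_inj (A : Type) (p : delay A) a1 a2 t1 t2 :
  takes p a1 t1 -> takes p a2 t2 -> a1 = a2 /\ t1 = t2.
Proof.
move=> h; elim: h a2 t2 => [a|q a t _ IH] a2 t2 h2.
  by inversion h2.
by inversion h2 as [|? ? ? h3]; subst; have [-> ->] := IH _ _ h3.
Qed.

CoFixpoint bind (A B : Type) (p : delay A) (f : A -> delay B) : delay B :=
  match p with
  | Now a => f a
  | Later q => Later (bind q f)
  end.

Notation "'let*' x ':=' p 'in' q" := (bind p (fun x => q))
  (at level 200, x binder, p at level 100, q at level 200,
   format "'[v' 'let*'  x  ':='  p  'in' '/' q ']'").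

Definition op (A : Type) (v : A) : delay A := Later (Now v).

Fixpoint foreach (S A : Type) (body : S -> A -> delay S) (s : S) (l : seq A)
    : delay S :=
  Later (if l is x :: l' then
           let* s' := body s x in foreach body s' l'
         else Now s).

Fixpoint mapM (A B : Type) (f : A -> delay B) (l : seq A) : delay (seq B) :=
  Later (if l is x :: l' then
           let* y := f x in
           let* ys := mapM f l' in
           Now (y :: ys)
         else Now [::]).

(* A counter loop: [iota] is never materialized, the step charged per iteration
   by [foreach] pays for the increment. *)
Definition for_upto (S : Type) (n : nat) (body : S -> nat -> delay S) (s : S)
    : delay S :=
  foreach body s (iota 0 n).

CoFixpoint loop_from (S A : Type) (body : S -> delay (S + A))
    (p : delay (S + A)) : delay A :=
  match p with
  | Now (inl s) => Later (loop_from body (body s))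
  | Now (inr a) => Now a
  | Later q => Later (loop_from body q)
  end.

(* Unbounded iteration: runs [body] until it answers [inr]. *)
Definition loop (S A : Type) (body : S -> delay (S + A)) (s : S) : delay A :=
  Later (loop_from body (body s)).

Fixpoint array_new (A : Type) (n : nat) (x : A) : delay (seq A) :=
  Later (if n is n'.+1 then
           let* a := array_new n' x in Now (x :: a)
         else Now [::]).

Definition array_get (A : Type) (x0 : A) (a : seq A) (i : nat) : delay A :=
  op (nth x0 a i).

Definition array_set (A : Type) (x0 : A) (a : seq A) (i : nat) (x : A)
    : delay (seq A) :=
  op (set_nth x0 a i x).

Definition lengthM (A : Type) (l : seq A) : delay nat :=
  foreach (fun c _ => op c.+1) 0%N l.

Fixpoint catM (A : Type) (l1 l2 : seq A) : delay (seq A) :=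
  Later (if l1 is x :: l1' then
           let* l := catM l1' l2 in Now (x :: l)
         else Now l2).

Fixpoint flattenM (A : Type) (ls : seq (seq A)) : delay (seq A) :=
  Later (if ls is l :: ls' then
           let* r := flattenM ls' in catM l r
         else Now [::]).

(** * The Ford-Fulkerson algorithm

  Residual networks in adjacency-list form.  Arcs are numbered; arc [2 i] is an
  arc of the network and arc [2 i + 1] is its reverse.  The residual capacity
  of [2 i] is its capacity minus its flow, that of [2 i + 1] is the flow of
  [2 i]. *)

Record network := Network {
  num_nodes : nat;
  arc_head : seq nat;
  residual : seq nat;
  adjacency : seq (seq nat)   (* numbers of the arcs leaving each node *)
}.

Definition set_residual (N : network) (r : seq nat) : network :=
  Network (num_nodes N) (arc_head N) r (adjacency N).

Definition empty_network (nodes arcs : nat) : delay network :=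
  let* arcs2 := op (2 * arcs)%N in
  let* hd := array_new arcs2 0%N in
  let* rs := array_new arcs2 0%N in
  let* ad := array_new nodes [::] in
  Now (Network nodes hd rs ad).

Definition reverse_arc (e : nat) : delay nat :=
  op (if odd e then e.-1 else e.+1).

(* Adds an arc from [u] to [v] of capacity [c] under the first unused arc
   number [e]; returns the next unused number. *)
Definition add_arc (N : network) (e u v c : nat) : delay (network * nat) :=
  let* e' := reverse_arc e in
  let* hd := array_set 0%N (arc_head N) e v in
  let* hd := array_set 0%N hd e' u in
  let* rs := array_set 0%N (residual N) e c in
  let* rs := array_set 0%N rs e' 0%N in
  let* au := array_get [::] (adjacency N) u in
  let* ad := array_set [::] (adjacency N) u (e :: au) in
  let* av := array_get [::] ad v in
  let* ad := array_set [::] ad v (e' :: av) in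
  let* next := op e.+2 in
  Now (Network (num_nodes N) hd rs ad, next).

(* Depth-first search from [s] along the arcs of positive residual capacity.
   Returns the array of visited nodes and, for every visited node other than
   [s], the arc through which it was reached. *)
Definition search (N : network) (s : nat) : delay (seq bool * seq nat) :=
  let* seen := array_new (num_nodes N) false in
  let* parent := array_new (num_nodes N) 0%N in
  let* seen := array_set false seen s true in
  loop (fun st : seq nat * seq bool * seq nat =>
      let: (stack, seen, parent) := st in
      if stack is u :: stack' then
        let* es := array_get [::] (adjacency N) u in
        let* st' := foreach (fun (st : seq nat * seq bool * seq nat) e =>
            let: (stack, seen, parent) := st in
            let* r := array_get 0%N (residual N) e in
            let* v := array_get 0%N (arc_head N) e in
            let* seen_v := array_get false seen v in
            let* new := op ((0 < r)%N && ~~ seen_v) in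
            if new then
              let* seen := array_set false seen v true in
              let* parent := array_set 0%N parent v e in
              Now (v :: stack, seen, parent)
            else Now st)
          (stack', seen, parent) es in
        Now (inl st')
      else Now (inr (seen, parent)))
    ([:: s], seen, parent).

(* The arcs of the path from [s] to [t] recorded in [parent]. *)
Definition trace_path (N : network) (parent : seq nat) (s t : nat)
    : delay (seq nat) :=
  loop (fun st : nat * seq nat =>
      let: (v, path) := st in
      let* stop := op (v == s) in
      if stop then Now (inr path)
      else
        let* e := array_get 0%N parent v in
        let* e' := reverse_arc e in
        let* u := array_get 0%N (arc_head N) e' in
        Now (inl (u, e :: path)))
    (t, [::]).

Definition augment (N : network) (path : seq nat) : delay network :=
  let* bottleneck := foreach (fun (b : option nat) e =>
      let* r := array_get 0%N (residual N) e in
      op (Some (if b is Some b' then minn b' r else r)))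
    None path in
  let: b := odflt 0%N bottleneck in
  let* rs := foreach (fun rs e =>
      let* r := array_get 0%N rs e in
      let* r := op (r - b)%N in
      let* rs := array_set 0%N rs e r in
      let* e' := reverse_arc e in
      let* r' := array_get 0%N rs e' in
      let* r' := op (r' + b)%N in
      array_set 0%N rs e' r')
    (residual N) path in
  Now (set_residual N rs).

Definition ford_fulkerson (N : network) (s t : nat) : delay network :=
  loop (fun N =>
      let* sp := search N s in
      let: (seen, parent) := sp in
      let* reached := array_get false seen t in
      if reached then
        let* path := trace_path N parent s t in
        let* N' := augment N path in
        Now (inl N')
      else Now (inr N))
    N.

Section Algorithm.
Context (R : realFieldType) (X : Type) (d : X -> X -> R).
Context (m : nat) (g : X -> nat).   (* groups are numbered 0, ..., m - 1 *)

(* A set of points with at most one point per group is an array with one cell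
   per group, so that looking for a point of a given group is one array read.
   [representatives p rad l] starts from {p} and scans [l], adding [x] whenever
   [d p x <= rad] and no point of the group of [x] is present. *)
Definition representatives (p : X) (rad : R) (l : seq X)
    : delay (seq (option X)) :=
  let* T := array_new m None in
  let* gp := op (g p) in
  let* T := array_set None T gp (Some p) in
  foreach (fun T x =>
      let* dpx := op (d p x) in
      let* close := op (dpx <= rad) in
      if close then
        let* gx := op (g x) in
        let* y := array_get None T gx in
        if y is Some _ then Now T else array_set None T gx (Some x)
      else Now T)
    T l.

Fixpoint list_of_table (T : seq (option X)) : delay (seq X) :=
  Later (if T is o :: T' then
           let* l := list_of_table T' in
           Now (if o is Some x then x :: l else l)
         else Now [::]).

(* [D] lists the local points with their distance to the points selected so
   far.  [tie j b x] decides whether, in round [j], a point [x] at the same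
   distance as the current best [b] replaces it: every choice of an element of
   the argmax is obtained for some [tie].  [dflt] is only used for empty [D]. *)
Definition farthest (tie : nat -> X -> X -> bool) (j : nat) (dflt : X * R)
    (D : seq (X * R)) : delay (X * R) :=
  foreach (fun (best : X * R) (xd : X * R) =>
      let: (b, db) := best in
      let: (x, dx) := xd in
      let* gt := op (db < dx) in
      let* eq := op (db == dx) in
      let* t := op (tie j b x) in
      Now (if gt || (eq && t) then xd else best))
    (head dflt D) (behead D).

Definition update_distances (p : X) (D : seq (X * R)) : delay (seq (X * R)) :=
  mapM (fun xd : X * R =>
      let: (x, dx) := xd in
      let* dxp := op (d x p) in
      let* lt := op (dxp < dx) in
      Now (x, if lt then dxp else dx))
    D.

(* Rounds [j, ..., j + c - 1]: the selected points and the final distances. *)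
Fixpoint select_farthest (tie : nat -> X -> X -> bool) (dflt : X * R)
    (c j : nat) (D : seq (X * R)) : delay (seq X * seq (X * R)) :=
  Later (if c is c'.+1 then
           let* pd := farthest tie j dflt D in
           let* D := update_distances pd.1 D in
           let* rest := select_farthest tie dflt c' j.+1 D in
           Now (pd.1 :: rest.1, rest.2)
         else Now ([::], D)).

(* The message (P_i, L_i) of a processor holding the points [Xi], with first
   point [p1].  The recorded distance of the farthest point in round [k + 1] is
   min_{1 <= j' <= k} d(p_{k+1}, p_{j'}). *)
Definition processor (k : nat) (tie : nat -> X -> X -> bool) (p1 : X)
    (Xi : seq X) : delay (seq X * seq X) :=
  let* D := mapM (fun x => let* dx := op (d x p1) in Now (x, dx)) Xi in
  let* k1 := op k.-1 in
  let* sel := select_farthest tie (p1, 0) k1 2 D in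
  let: (ps, D) := sel in
  let: Pi := p1 :: ps in
  let* last := farthest tie k.+1 (p1, 0) D in
  let* r := op (last.2 / 2) in
  let* rad := op (2 * r) in
  let* tables := mapM (fun p => representatives p rad Xi) Pi in
  let* lists := mapM list_of_table tables in
  let* Li := flattenM lists in
  Now (Pi, Li).

(* Greedy scan; the first point is added since P is still empty. *)
Definition scattered (rad : R) (l : seq X) : delay (seq X) :=
  foreach (fun P q =>
      let* far := foreach (fun (far : bool) p =>
          let* dpq := op (d p q) in
          let* gt := op (rad < dpq) in
          Now (far && gt))
        true P in
      Now (if far then q :: P else P))
    [::] l.

(* Node 0 is the source, node 1 the sink, node [2 + a] stands for the a-th set,
   node [2 + #sets + j] for group [j].  [caps] is the array of capacities.
   Besides the network, returns for each arc from a set to a group [j] its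
   number and the point of group [j] in the set.  These arcs get capacity 1:
   the flow through a set node is at most 1 anyway. *)
Definition build_network (caps : seq nat) (Ns : seq (seq (option X)))
    : delay (network * seq (nat * X)) :=
  let* c := lengthM Ns in
  let* nodes := op (c + m + 2)%N in
  let* arcs := op (c + c * m + m)%N in
  let* N := empty_network nodes arcs in
  let* Ne := for_upto c (fun (st : network * nat) a =>
      let* u := op (2 + a)%N in
      add_arc st.1 st.2 0 u 1)
    (N, 0%N) in
  let* st := foreach (fun (st : network * nat * seq (nat * X) * nat) T =>
      let: (Ne, mids, a) := st in
      let* u := op (2 + a)%N in
      let* st' := for_upto m (fun (st : network * nat * seq (nat * X)) j =>
          let: (N, e, mids) := st in
          let* o := array_get None T j in
          if o is Some x then
            let* v := op (2 + c + j)%N in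
            let* Ne := add_arc N e u v 1 in
            Now (Ne, (e, x) :: mids)
          else Now st)
        (Ne, mids) in
      let* a' := op a.+1 in
      Now (st', a'))
    (Ne, [::], 0%N) Ns in
  let: (Ne, mids, _) := st in
  let* Ne := for_upto m (fun (st : network * nat) j =>
      let* u := op (2 + c + j)%N in
      let* kj := array_get 0%N caps j in
      add_arc st.1 st.2 u 1 kj)
    Ne in
  Now (Ne.1, mids).

Definition selected_points (N : network) (mids : seq (nat * X))
    : delay (seq X) :=
  foreach (fun S (ex : nat * X) =>
      let: (e, x) := ex in
      let* e' := reverse_arc e in
      let* flow := array_get 0%N (residual N) e' in
      let* used := op (0 < flow)%N in
      Now (if used then x :: S else S))
    [::] mids.

Definition coordinator (caps : seq nat) (tau : R)
    (messages : seq (seq X * seq X)) : delay (seq X) :=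
  let* Ps := mapM (fun PL : seq X * seq X => Now PL.1) messages in
  let* Ls := mapM (fun PL : seq X * seq X => Now PL.2) messages in
  let* X' := flattenM Ps in
  let* L := flattenM Ls in
  let* tau10 := op (10 * tau) in
  let* tau5 := op (5 * tau) in
  let* P := scattered tau10 X' in
  let* Ns := mapM (fun q => representatives q tau5 L) P in
  let* Nm := build_network caps Ns in
  let: (N, mids) := Nm in
  let* N := ford_fulkerson N 0 1 in
  selected_points N mids.

End Algorithm.

Section FairCenter.
Context (R : realType) (X : finType) (d : X -> X -> R).
Context (m : nat) (g : X -> 'I_m) (kc : 'I_m -> nat).

Definition is_metric : Prop :=
  [/\ forall x y, 0 <= d x y,
      forall x y, d x y = 0 <-> x = y,
      forall x y, d x y = d y x &
      forall x y z, d x z <= d x y + d y z].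

(* With the convention that a minimum over the empty set is +oo, an empty set
   of centers never attains the optimum of a nonempty space. *)
Definition clustering_cost (A B : {set X}) : \bar R :=
  \big[Order.max/-oo%E]_(b in B) \big[Order.min/+oo%E]_(a in A) (d a b)%:E.

Definition feasible (S : {set X}) : bool :=
  [forall j, #|[set x in S | g x == j]| <= kc j]%N.

Definition OPT : \bar R :=
  \big[Order.min/+oo%E]_(S : {set X} | feasible S) clustering_cost S [set: X].

End FairCenter.

(* An input of the distributed algorithm together with the arbitrary choices
   made in its execution: the order in which each [X_i] is scanned, the first
   point of each processor, and the way ties in the argmax are broken. *)
Record execution (R : realType) := Execution {
  points : finType;
  dist : points -> points -> R;
  dist_metric : is_metric dist;
  groups : nat;
  group : points -> 'I_groups;
  capacity : 'I_groups -> nat;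
  threshold : R;
  threshold_ge_OPT : (OPT dist group capacity <= threshold%:E)%E;
  processors : nat;
  processors_gt0 : (0 < processors)%N;
  part : 'I_processors -> seq points;
  part_split : perm_eq (flatten [seq part i | i <- enum 'I_processors])
                       (enum points);
  part_equal : forall i, (size (part i) * processors = #|points|)%N;
  part_large : forall i, (\sum_j capacity j + 1 <= size (part i))%N;
  first_point : 'I_processors -> points;
  first_point_in : forall i, first_point i \in part i;
  tie_break : 'I_processors -> nat -> points -> points -> bool
}.

Definition total_capacity (R : realType) (E : execution R) : nat :=
  \sum_(j < groups E) capacity j.

Definition processor_program (R : realType) (E : execution R)
    (i : 'I_(processors E)) : delay (seq (points E) * seq (points E)) :=
  processor (@dist R E) (groups E) (fun x => val (group x))
    (total_capacity E) (tie_break i) (first_point i) (part i).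

Definition coordinator_program (R : realType) (E : execution R)
    (messages : 'I_(processors E) -> seq (points E) * seq (points E))
    : delay (seq (points E)) :=
  coordinator (@dist R E) (groups E) (fun x => val (group x))
    [seq capacity j | j <- enum 'I_(groups E)] (threshold E)
    [seq messages i | i <- enum 'I_(processors E)].

(* The processors run in parallel, then the coordinator on their messages. *)
Definition running_time (R : realType) (E : execution R) (T : nat) : Prop :=
  exists messages (t : 'I_(processors E) -> nat) S tc,
    [/\ forall i, takes (processor_program i) (messages i) (t i),
        takes (coordinator_program messages) S tc &
        T = (\max_i t i + tc)%N].

(* Main.v *)
(** Running times are bounded by a weakest-precondition calculus for [delay].
  Everything except the search and the augmentations of Ford-Fulkerson is a
  bounded loop.  Each of the following facts accounts for one factor:
  - points pairwise more than [10 tau] apart have distinct centers in a feasible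
    solution of cost at most [tau], so the scan of the coordinator keeps at most
    [k] points (the same fact forces [k > 0]);
  - a search pushes every node at most once, so it takes time linear in the
    size [O(mk)] of the network, and the parents it records point backwards in
    the order of discovery, so tracing them terminates within the number of
    nodes;
  - the recorded path leaves the source once and never returns to it, so each
    augmentation decreases the total residual capacity of the arcs leaving the
    source, which is initially at most [k]. *)

Require Import Defs.
From HB Require Import structures.
From mathcomp Require Import all_boot all_order all_algebra.
From mathcomp Require Import reals constructive_ereal exp.
From mathcomp Require Import zify ring lra.

Set Implicit Arguments.
Unset Strict Implicit.
Unset Printing Implicit Defensive.

Import Order.TTheory GRing.Theory Num.Theory.

(** * Weakest preconditions with time for delay programs *)

Definition ensures (A : Type) (p : delay A) (Q : A -> nat -> Prop) : Prop :=
  exists a t, takes p a t /\ Q a t.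

Section Ensures.
Context (A : Type).
Implicit Types (Q : A -> nat -> Prop).

(** A cofixpoint reduces only under a match; rewriting with this identity exposes its first
    constructor. *)
Lemma delay_unfold (p : delay A) :
  p = match p with Now a => Now a | Later q => Later q end.
Proof. by case: p. Qed.

Lemma ensures_now a Q : Q a 0 -> ensures (Now a) Q.
Proof. by move=> Qa; exists a, 0; split=> //; constructor. Qed.

Lemma ensures_later p Q :
  ensures p (fun a t => Q a t.+1) -> ensures (Later p) Q.
Proof. by move=> [a [t [ht Qa]]]; exists a, t.+1; split=> //; constructor. Qed.

Lemma ensures_op v Q : Q v 1 -> ensures (op v) Q.
Proof. by move=> Qv; apply: ensures_later; apply: ensures_now. Qed.

Lemma ensures_weaken p Q Q' :
  ensures p Q -> (forall a t, Q a t -> Q' a t) -> ensures p Q'.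
Proof. by move=> [a [t [ht Qa]]] h; exists a, t; split=> //; apply: h. Qed.

End Ensures.

Section EnsuresBind.
Context (A B : Type).

Lemma bind_now (a : A) (f : A -> delay B) : bind (Now a) f = f a.
Proof. by rewrite [LHS]delay_unfold /=; case: (f a). Qed.

Lemma bind_later (p : delay A) (f : A -> delay B) :
  bind (Later p) f = Later (bind p f).
Proof. by rewrite [LHS]delay_unfold. Qed.

Lemma ensures_bind (p : delay A) (f : A -> delay B) Q :
  ensures p (fun a t => ensures (f a) (fun b t' => Q b (t + t'))) ->
  ensures (bind p f) Q.
Proof.
move=> [a [t [ht [b [t' [hb Qb]]]]]]; exists b, (t + t'); split=> // {Qb Q}.
elim: ht hb => [a0|q a0 s _ IH] hb; first by rewrite bind_now.
by rewrite bind_later addSn; constructor; apply: IH.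
Qed.

Lemma ensures_bind_op (v : A) (f : A -> delay B) Q :
  ensures (f v) (fun b t => Q b t.+1) -> ensures (bind (op v) f) Q.
Proof. by move=> h; apply: ensures_bind; apply: ensures_op. Qed.

End EnsuresBind.

Section EnsuresLoops.
Context (A B S : Type).

(** [I] sees the items still to be processed and the time elapsed. Carrying elapsed time through the
    induction allows amortized bounds as invariants. *)
Lemma ensures_foreach (body : S -> A -> delay S)
    (I : seq A -> S -> nat -> Prop) (Q : S -> nat -> Prop) s l :
  I l s 0 ->
  (forall x l s t, I (x :: l) s t ->
     ensures (body s x) (fun s' t' => I l s' (t + t').+1)) ->
  (forall s t, I [::] s t -> Q s t.+1) ->
  ensures (foreach body s l) Q.
Proof.
move=> I0 Istep Iend.
suff h t : I l s t -> ensures (foreach body s l) (fun a t' => Q a (t + t')).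
  exact: h I0.
elim: l s t {I0} => [|x l IH] s t Is /=; apply: ensures_later.
  by apply: ensures_now; rewrite addn1; apply: Iend.
apply: ensures_bind; apply: ensures_weaken (Istep _ _ _ _ Is) _ => s' t' Is'.
apply: ensures_weaken (IH _ _ Is') _ => a t2.
by rewrite !addnS !addSn addnA.
Qed.

Lemma ensures_foreach_const (body : S -> A -> delay S) c
    (I : seq A -> S -> Prop) s l :
  I l s ->
  (forall x l s, I (x :: l) s ->
     ensures (body s x) (fun s' t => I l s' /\ t <= c)) ->
  ensures (foreach body s l) (fun s' t => I [::] s' /\ t <= c.+1 * size l + 1).
Proof.
move=> I0 Istep; set n := size l.
apply: (@ensures_foreach _
  (fun l' s t => I l' s /\ t + c.+1 * size l' <= c.+1 * n)); first by split.
- move=> x l' s' t [Is' ht]; apply: ensures_weaken (Istep _ _ _ Is') _.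
  by move=> s2 t2 [Is2 ht2]; split=> //; move: ht => /=; lia.
- by move=> s' t [Is' /= ht]; split=> //; lia.
Qed.

Lemma ensures_mapM (f : A -> delay B) (P : B -> Prop) c l :
  (forall x, ensures (f x) (fun y t => P y /\ t <= c)) ->
  ensures (mapM f l) (fun ys t =>
    [/\ size ys = size l, List.Forall P ys & t <= c.+1 * size l + 1]).
Proof.
move=> hf; elim: l => [|x l IH] /=; apply: ensures_later.
  by apply: ensures_now; split; rewrite ?muln0.

apply: ensures_bind; apply: ensures_weaken (hf x) _ => y t [Py ht].
apply: ensures_bind; apply: ensures_weaken IH _ => ys t' [sz Pys ht'].
apply: ensures_now; split; [by rewrite /= sz|by constructor|lia].
Qed.

(** Steps of the body pass through [loop_from] one for one, so the time of an iteration adds to the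
    time of what follows. *)
Lemma takes_loop_from (body : S -> delay (S + A)) p r a t t' :
  takes p r t -> takes (loop_from body (Now r)) a t' ->
  takes (loop_from body p) a (t + t').
Proof.
elim=> [//|q r' t0 _ IH] h.
by rewrite [loop_from _ _]delay_unfold /= addSn; constructor; apply: IH.
Qed.

(* Every iteration takes a step, so a bound on the elapsed time under the
   invariant is enough for termination. *)
Lemma ensures_loop (body : S -> delay (S + A)) (I : S -> nat -> Prop) bound
    (Q : A -> nat -> Prop) s :
  (forall s t, I s t -> t <= bound) ->
  I s 1 ->
  (forall s t, I s t -> ensures (body s) (fun r t' =>
     match r with inl s' => I s' (t + t').+1 | inr a => Q a (t + t') end)) ->
  ensures (loop body s) Q.
Proof.
move=> Ibound I0 Istep; apply: ensures_later.
(* Induction on the remaining budget: [t] grows in every iteration, so [bound - t] decreases. *)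
suff h n t : bound - t < n -> I s t ->
    ensures (loop_from body (body s)) (fun a t' => Q a (t + t')).
  by apply: ensures_weaken (h _ _ (ltnSn _) I0) _ => a t; rewrite add1n.
elim: n s t {I0} => [//|n IH] s t hn Is.
have [r [t1 [h1 hr]]] := Istep _ _ Is; case: r => [s'|a] in h1 hr.
  have ht := Ibound _ _ hr.
  have [|a [t2 [h2 Qa]]] := IH s' _ _ hr; first by lia.
  exists a, (t1 + t2.+1); split; last by rewrite addnA addnS -addSn.
  apply: takes_loop_from h1 _.
  by rewrite [loop_from _ _]delay_unfold /=; constructor.
exists a, (t1 + 0); split; last by rewrite addn0.
by apply: takes_loop_from h1 _; rewrite [loop_from _ _]delay_unfold /=; constructor.
Qed.

End EnsuresLoops.

Section EnsuresArrays.
Context (A : Type).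

Lemma ensures_array_new n (x : A) :
  ensures (array_new n x) (fun a t => a = nseq n x /\ t = n.+1).
Proof.
elim: n => [|n IH]; apply: ensures_later; first by apply: ensures_now.
apply: ensures_bind; apply: ensures_weaken IH _ => a t [-> ->].
by apply: ensures_now; rewrite addn0.
Qed.

Lemma ensures_lengthM (l : seq A) :
  ensures (lengthM l) (fun c t => c = size l /\ t <= 2 * size l + 1).
Proof.
apply: ensures_weaken (ensures_foreach_const (c := 1)
  (I := fun l' c => c + size l' = size l) _ _) _ => //.
- by move=> x l' c /= hc; apply: ensures_op; split=> //; lia.
- by move=> c t [/= hc ht]; split=> //; lia.
Qed.

Lemma ensures_catM (l1 l2 : seq A) :
  ensures (catM l1 l2) (fun l t => l = l1 ++ l2 /\ t = (size l1).+1).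
Proof.
elim: l1 => [|x l1 IH]; apply: ensures_later; first by apply: ensures_now.
apply: ensures_bind; apply: ensures_weaken IH _ => a t [-> ->].
by apply: ensures_now; rewrite addn0.
Qed.

Lemma ensures_flattenM (ls : seq (seq A)) :
  ensures (flattenM ls) (fun l t =>
    l = flatten ls /\ t = size (flatten ls) + 2 * size ls + 1).
Proof.
elim: ls => [|l ls IH]; apply: ensures_later; first by apply: ensures_now.
apply: ensures_bind; apply: ensures_weaken IH _ => r t [-> ->].
apply: ensures_weaken (ensures_catM _ _) _ => a t' [-> ->].
by rewrite /= size_cat; split=> //; lia.
Qed.

End EnsuresArrays.

(* The match is syntactic: up to conversion, [ensures_bind_op] would also enter
   any subprogram that starts with a primitive operation. *)
Ltac ops := repeat (
  lazymatch goal with |- ensures (bind ?p _) _ =>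
    lazymatch p with
    | op _ => idtac
    | array_get _ _ _ => idtac
    | array_set _ _ _ _ => idtac
    | reverse_arc _ => idtac
    end
  end; apply: ensures_bind_op; cbv beta).

(** * Residual networks and the source capacity *)

Definition rev_arc (e : nat) : nat := if odd e then e.-1 else e.+1.

Lemma rev_arcK : involutive rev_arc.
Proof. by rewrite /rev_arc; case=> [|e] //=; case E: (odd e); rewrite /= E. Qed.

Definition head_of (N : network) e := nth 0 (arc_head N) e.
Definition tail_of (N : network) e := nth 0 (arc_head N) (rev_arc e).
Definition cap_of (N : network) e := nth 0 (residual N) e.
Definition arcs_from (N : network) u := nth [::] (adjacency N) u.

(** [M] is an exclusive bound on the arc numbers in use. Residual capacities do not occur, so
    augmenting preserves this by conversion; the bound on the adjacency lists makes a search
    linear. *)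
Definition well_formed (N : network) (M : nat) : Prop :=
  (forall u e : nat, e \in arcs_from N u ->
    [/\ e < M, tail_of N e = u & head_of N e < num_nodes N]) /\
  \sum_(u < num_nodes N) size (arcs_from N u) <= M.

(** Termination measure of the augmentation loop. *)
Definition source_cap (N : network) (s M : nat) : nat :=
  \sum_(e < M | tail_of N e == s) cap_of N e.

(** * Depth-first search *)

Section Search.
Context (N : network) (M s : nat).

(* The visited nodes in reverse order of discovery. *)
Inductive discovered (parent : seq nat) : seq nat -> Prop :=
  | discovered_source : discovered parent [:: s]
  | discovered_step (v : nat) (l : seq nat) : discovered parent l -> v \notin l ->
      0 < cap_of N (nth 0 parent v) -> nth 0 parent v < M ->
      head_of N (nth 0 parent v) = v -> tail_of N (nth 0 parent v) \in l ->
      discovered parent (v :: l).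

Lemma discovered_uniq parent l : discovered parent l -> uniq l.
Proof. by elim=> [//|v l' _ u vl _ _ _ _] /=; rewrite vl. Qed.

(** The derivation for [l] reads parents at nodes of [l] only, and [v] is not one of them. *)
Lemma discovered_set_parent parent v e l :
  v \notin l -> discovered parent l -> discovered (set_nth 0 parent v e) l.
Proof.
move=> + h; elim: h => [|w l' _ IH wl c lt hd tl]; first by constructor.
rewrite inE negb_or => /andP[vw vl'].
have E : nth 0 (set_nth 0 parent v e) w = nth 0 parent w.
  by rewrite nth_set_nth /= eq_sym (negbTE vw).
by constructor; rewrite ?E //; apply: IH.
Qed.

(** What was found up to [v] is itself a discovery order. Tracing parents therefore walks down ever
    shorter lists. *)
Lemma discovered_from parent l (v : nat) : discovered parent l -> v \in l ->
  exists2 l' : seq nat, discovered parent (v :: l') & size l' < size l.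
Proof.
elim=> [|w l' hl' IH wl c lt hd tl].
  by rewrite inE => /eqP->; exists [::] => //; constructor.
rewrite inE => /orP[/eqP->|/IH[l2 h2 sz]]; last by exists l2 => //=; apply: leqW.
by exists l' => //; constructor.
Qed.

(* Pays for popping [u] and scanning its arcs in [search]. *)
Definition weight u := 3 + 7 * size (arcs_from N u).

(** Potential of the amortized analysis: the work still owed to unseen nodes and to nodes on the
    stack. Discovering a node moves its weight from the first sum to the second; popping it releases
    the weight. *)
Definition pending (stack : seq nat) (seen : seq bool) :=
  \sum_(v < num_nodes N | ~~ nth false seen v) weight v +
  \sum_(v <- stack) weight v.

Lemma pending_cons u stack seen :
  pending (u :: stack) seen = weight u + pending stack seen.
Proof. by rewrite /pending big_cons addnCA. Qed.

Lemma pending_push v stack seen : v < num_nodes N -> nth false seen v = false ->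
  pending (v :: stack) (set_nth false seen v true) = pending stack seen.
Proof.
move=> vV hv; rewrite /pending big_cons addnCA addnA; congr (_ + _).
rewrite [RHS](bigD1 (Ordinal vV)) /= ?hv //; congr (_ + _).
apply: eq_bigl => u; rewrite nth_set_nth /= -val_eqE /=.
by case: eqP => //=; rewrite ?andbT ?andbF.
Qed.

Definition search_inv (stack : seq nat) (seen : seq bool) (parent disc : seq nat) :=
  [/\ discovered parent disc, forall v, nth false seen v = (v \in disc),
      {subset stack <= disc} & all (fun v => v < num_nodes N) disc].

Lemma ensures_search : well_formed N M -> s < num_nodes N ->
  ensures (search N s) (fun sp t => t <= 5 * num_nodes N + 7 * M + 4 /\
    exists disc : seq nat, [/\ discovered sp.2 disc,
      forall v, nth false sp.1 v = (v \in disc) & size disc <= num_nodes N]).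
Proof.
move=> [wf_arc wf_size] sV; rewrite /search.
set V := num_nodes N in sV wf_size *.
apply: ensures_bind; apply: ensures_weaken (ensures_array_new _ _) _ => _ _ [-> ->].
apply: ensures_bind; apply: ensures_weaken (ensures_array_new _ _) _ => _ _ [-> ->].
ops.
have total : \sum_(v < V) weight v <= 3 * V + 7 * M.
  rewrite big_split /= sum_nat_const card_ord -big_distrr /=.
  by rewrite mulnC leq_add2l leq_mul2l.
(* The budget is the bound on the total weight plus one step for entering the loop. The discovery
   order is ghost state, hence the existential. *)
apply: (ensures_loop
  (I := fun st t => exists2 disc, search_inv st.1.1 st.1.2 st.2 disc &
                    t + pending st.1.1 st.1.2 <= (3 * V + 7 * M).+1)
  (bound := (3 * V + 7 * M).+1)).
- by move=> st t [disc _]; lia.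
- exists [:: s] => /=.
    split=> //; first by constructor.
      by move=> v; rewrite nth_set_nth /= nth_nseq if_same inE; case: eqP.
    by rewrite /= sV.
  rewrite pending_push // ?nth_nseq ?if_same //.
  rewrite /pending big_nil addn0 add1n ltnS.
  by under eq_bigl do rewrite nth_nseq if_same.
move=> [[[|u stack] seen] parent] t [disc inv ht].
  apply: ensures_now; case: inv => [hd hs _ hV].
  split; first by move: ht; rewrite /=; lia.
  exists disc; split=> //.
  rewrite -(size_iota 0 V); apply: uniq_leq_size; first exact: discovered_uniq hd.
  by move=> v /(allP hV); rewrite mem_iota.
ops; set es := nth [::] (adjacency N) u.
have ud : u \in disc by case: inv => _ _ sub _; apply: sub; rewrite inE eqxx.
apply: ensures_bind.
(* Each remaining arc is worth 7: one iteration step, four operations and at most two writes. *)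
apply: (@ensures_foreach _ _ _
  (fun es' st t => {subset es' <= es} /\ exists2 disc,
     search_inv st.1.1 st.1.2 st.2 disc /\ u \in disc &
     pending st.1.1 st.1.2 + (t + 7 * size es') <=
       pending stack seen + 7 * size es)).
- split=> //; exists disc => //; split=> //.
  by case: inv => h1 h2 h3 h4; split=> // v vs; apply: h3; rewrite inE vs orbT.
- move=> e es' [[stk sn] par] t' [sub [disc' [[h1 h2 h3 h4] ud'] pt]].
  have [eM te he] : [/\ e < M, tail_of N e = u & head_of N e < V].
    by apply: wf_arc; apply: sub; rewrite inE eqxx.
  have sub' : {subset es' <= es} by move=> x xs; apply: sub; rewrite inE xs orbT.
  ops; case: ifP => [/andP[r0 nseen]|_]; last first.
    apply: ensures_now; split=> //; exists disc' => //.
    by move: pt => /=; lia.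
  ops; apply: ensures_now; split=> //=.
  rewrite -/(head_of N e) in nseen *.
  have vd : head_of N e \notin disc' by rewrite -h2.
  have Ee : nth 0 (set_nth 0 par (head_of N e) e) (head_of N e) = e.
    by rewrite nth_set_nth /= eqxx.
  exists (head_of N e :: disc').
    split; last by rewrite inE ud' orbT.
    split.
    + by constructor; rewrite ?Ee ?te //; apply: discovered_set_parent.
    + by move=> v; rewrite nth_set_nth /= inE h2; case: eqP.
    + move=> v; rewrite !inE => /orP[->//|/h3->]; exact: orbT.
    + by rewrite /= he.
  rewrite pending_push //; last exact: negbTE.
  by move: pt => /=; lia.
- move=> [[stk sn] par] t' [_ [disc' [inv' _] pt]].
  apply: ensures_now; exists disc' => //.
  move: ht pt; rewrite /= pending_cons /weight /arcs_from -/es.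
  by move: (pending _ _) (pending _ _) => p q; lia.
Qed.

End Search.

(** * Augmenting paths and Ford-Fulkerson *)

Section Augmentation.
Context (N : network) (M s t : nat).

(** The equation with [behead] says that the path is nonempty with first arc [e0]; the later arcs do
    not leave [s], and no arc enters it. *)
Definition augmenting (path : seq nat) : Prop :=
  {in path, forall e, [/\ 0 < cap_of N e, e < M & head_of N e != s]} /\
  exists2 e0, path = e0 :: behead path &
    tail_of N e0 = s /\ {in behead path, forall e, tail_of N e != s}.

(** The current node heads a discovery list, and moving to its parent passes to a strictly shorter
    one; a round costs 5 steps. As the walk stops at [s], the head of every recorded arc differs
    from [s]. *)
Lemma ensures_trace_path parent disc :
  discovered N M s parent disc -> t \in disc -> t != s ->
  ensures (trace_path N parent s t) (fun path time =>
    [/\ time <= 5 * size disc + 2, size path <= size disc & augmenting path]).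
Proof.
move=> hd td ts; rewrite /trace_path.
apply: (ensures_loop
  (I := fun st time => [/\
     exists2 l, discovered N M s parent (st.1 :: l) &
       time + 5 * size l <= 5 * size disc + 1 /\
       size st.2 + size l <= size disc,
     {in st.2, forall e, [/\ 0 < cap_of N e, e < M & head_of N e != s]},
     {in behead st.2, forall e, tail_of N e != s} &
     if st.2 is e :: _ then tail_of N e = st.1 else st.1 = t])
  (bound := 5 * size disc + 1)).
- by move=> [v path] time [[l _ [ht _]] _ _ _]; lia.
- split=> //=; have [l hl sz] := discovered_from hd td.
  by exists l => //; lia.
move=> [v path] time /= [[l hl [ht hsz]] ok tl hdp].
ops; case: eqP => [vs|/eqP vs].
  apply: ensures_now; split; [lia|lia|split=> //].
  case: path ok tl hdp {hsz} => [|e path] ok tl hdp.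
    by rewrite -hdp vs eqxx in ts.
  by exists e => //; split=> //; rewrite hdp.
ops; apply: ensures_now => /=; set e := nth 0 parent v.
(* Since [v] is not [s], the list [v :: l] comes from [discovered_step]. *)
have [c lt hv tv hl'] : [/\ 0 < cap_of N e, e < M, head_of N e = v,
    tail_of N e \in l & discovered N M s parent l].
  by inversion hl; subst; first by rewrite eqxx in vs.
have [l2 hl2 sz2] := discovered_from hl' tv.
split=> //.
- by exists l2 => //; lia.
- by move=> e'; rewrite inE => /orP[/eqP->|/ok//]; split=> //; rewrite hv.
- move=> e'; case: path ok tl hdp {hsz} => [|e1 path] //= ok tl hdp.
  by rewrite inE => /orP[/eqP->|/tl//]; rewrite hdp.
Qed.

(** Reverse arcs gain capacity, but the reverse of a path arc leaves the head of that arc, which is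
    not [s]. Among the arcs leaving [s] only [e0] changes, and it loses the bottleneck. *)
Lemma ensures_augment path : augmenting path ->
  ensures (augment N path) (fun N' time => time <= 11 * size path + 2 /\
    exists2 rs, N' = set_residual N rs &
      source_cap N' s M < source_cap N s M).
Proof.
move=> [ok [e0 Epath [te0 trest]]]; rewrite /augment.
apply: ensures_bind.
apply: ensures_weaken (ensures_foreach_const (c := 2)
  (I := fun (l : seq nat) b => {subset l <= path} /\
     if b is Some b' then 0 < b' else l = path) _ _) _.
- by split.
- move=> e l b [sub hb]; ops; apply: ensures_op.
  have [|ce _ _] := ok e; first by apply: sub; rewrite inE eqxx.
  do !split=> //; first by move=> x xl; apply: sub; rewrite inE xl orbT.
  by case: b hb => // b' hb; rewrite leq_min hb.
move=> [b|] t1 [[_ hb] ht1]; last by rewrite Epath in hb.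
have e0p : e0 \in path by rewrite Epath inE eqxx.
have [c0 e0M he0] := ok _ e0p.
apply: ensures_bind.
(* Left: nothing is processed yet. Right: [e0] is done, and the remaining arcs leave the capacities
   at [s] unchanged. *)
apply: ensures_weaken (ensures_foreach_const (c := 7)
  (I := fun l rs => (l = path /\ rs = residual N) \/
     {subset l <= behead path} /\ forall e, tail_of N e = s ->
       nth 0 rs e = if e == e0 then cap_of N e0 - b else cap_of N e) _ _) _.
- by left.
- move=> e l rs I; ops; apply: ensures_op; split=> //; right.
  case: I => [[El ->]|[sub hrs]].
    have [Ee Erest] : e = e0 /\ l = behead path.
      by rewrite -El; move: Epath; rewrite -El => -[].
    rewrite Erest {}Ee; split=> // a ta.
    rewrite -/(rev_arc e0) nth_set_nth /= -/(rev_arc e0).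
    have -> : (a == rev_arc e0) = false.
      by apply: contra_neqF he0 => /eqP Ea; rewrite -ta Ea /tail_of rev_arcK.
    by rewrite nth_set_nth /=; case: eqP.
  split=> [x xl|a ta]; first by apply: sub; rewrite inE xl orbT.
  have er : e \in behead path by apply: sub; rewrite inE eqxx.
  have [_ _ he] := ok e (mem_behead er).
  rewrite -/(rev_arc e) nth_set_nth /= -/(rev_arc e).
  have -> : (a == rev_arc e) = false.
    by apply: contra_neqF he => /eqP Ea; rewrite -ta Ea /tail_of rev_arcK.
  rewrite nth_set_nth /=; have -> : (a == e) = false.
    by apply: contra_neqF (trest _ er) => /eqP Ea; rewrite -Ea.
  exact: hrs.
move=> rs t2 [I ht2]; apply: ensures_now; split; first by lia.
exists rs => //; case: I => [[El _]|[_ hrs]]; first by rewrite Epath in El.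
rewrite /source_cap.
rewrite (bigD1 (Ordinal e0M)) /=; last exact/eqP.
rewrite [leqRHS](bigD1 (Ordinal e0M)) /=; last exact/eqP.
rewrite -addSn leq_add //.
  (* Strict despite truncated subtraction: [b] and the capacity of [e0] are both positive. *)
  by rewrite {1}/cap_of /= hrs // eqxx; lia.
apply: leq_sum => e /andP[/eqP te ne]; rewrite /cap_of /= hrs //.
by rewrite -val_eqE /= in ne; rewrite (negbTE ne).
Qed.

End Augmentation.

Lemma ensures_ford_fulkerson N M s t c :
  well_formed N M -> s < num_nodes N -> t != s -> source_cap N s M <= c ->
  ensures (ford_fulkerson N s t) (fun _ time =>
    time <= c.+1 * (21 * num_nodes N + 7 * M + 10) + 1).
Proof.
move=> wf sV ts hc; rewrite /ford_fulkerson.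
(* [K] pays for one round: search, test of [t], tracing, augmenting along at most [num_nodes N]
   arcs, and the loop step. The factor [c.+1] counts at most [c] augmentations and the final failing
   search. *)
set K := 21 * num_nodes N + 7 * M + 10.
apply: (ensures_loop
  (I := fun N' time => [/\ well_formed N' M, num_nodes N' = num_nodes N &
     time + (source_cap N' s M).+1 * K <= c.+1 * K + 1])
  (bound := c.+1 * K + 1)).
- by move=> N' time [_ _ ?]; lia.
- by split=> //; rewrite addnC leq_add2r leq_mul2r ltnS hc orbT.
move=> N' time [wf' EV ht].
apply: ensures_bind.
apply: ensures_weaken (ensures_search wf' _) _; first by rewrite EV.
move=> [seen parent] t1 [ht1 [disc [hd hs szd]]].
ops; rewrite EV in ht1 szd; case: ifP => /= [seen_t|_]; last first.
  apply: ensures_now; move: ht; rewrite mulSn.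
  by move: (_ * K) (_ * K) => x y; rewrite /K; lia.
rewrite hs in seen_t.
apply: ensures_bind.
apply: ensures_weaken (ensures_trace_path hd seen_t ts) _ => path t2 [ht2 szp aug].
apply: ensures_bind.
apply: ensures_weaken (ensures_augment aug) _ => _ t3 [ht3 [rs -> dec]].
apply: ensures_now; split=> //.
apply: leq_trans ht.
have : (source_cap (set_residual N' rs) s M).+1 * K <= source_cap N' s M * K.
  by rewrite leq_mul2r dec orbT.
by rewrite !mulSn; move: (_ * K) (_ * K) => x y; rewrite /K; lia.
Qed.

(** * Building the flow network *)

Lemma nth_set_nthE (T : Type) (x0 : T) s i y j :
  nth x0 (set_nth x0 s i y) j = if j == i then y else nth x0 s j.
Proof. by rewrite nth_set_nth. Qed.

Lemma rev_arc_lt e x : ~~ odd e -> x < e -> rev_arc x < e.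
Proof. by rewrite /rev_arc; case: ifP; lia. Qed.

Lemma sum_eq_le1 n u : \sum_(w < n) (w == u :> nat) <= 1.
Proof.
case: (ltnP u n) => hu; last first.
  rewrite big1 // => w _; apply/eqP; rewrite eqb0; apply/eqP.
  by move: (ltn_ord w); lia.
rewrite (bigD1 (Ordinal hu)) //= eqxx big1 // => w /negbTE.
by rewrite -val_eqE => ->.
Qed.

(** As [e] is even, [e] and [e.+1] form a fresh pair of mutually reverse arcs, and the pairs below
    [e] keep their heads and tails. *)
Lemma ensures_add_arc N e u v c :
  ~~ odd e -> well_formed N e -> u < num_nodes N -> v < num_nodes N ->
  ensures (add_arc N e u v c) (fun Ne t =>
    [/\ t = 10, Ne.2 = e.+2, num_nodes Ne.1 = num_nodes N,
        well_formed Ne.1 e.+2 &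
        source_cap Ne.1 0 e.+2 <= source_cap N 0 e + (u == 0) * c]).
Proof.
move=> ev [wf_arc wf_size] uV vV; rewrite /add_arc; ops; apply: ensures_now.
rewrite (negbTE ev); set N' := Network _ _ _ _; split=> //=.
- have head_old x : x < e -> head_of N' x = head_of N x.
    move=> xe; rewrite /head_of /N' /= !nth_set_nthE !ifN //; lia.
  have tail_old x : x < e -> tail_of N' x = tail_of N x.
    by move=> xe; apply: head_old; apply: rev_arc_lt.
  have re : rev_arc e = e.+1 by rewrite /rev_arc (negbTE ev).
  have re1 : rev_arc e.+1 = e by rewrite -re rev_arcK.
  have hd_e : head_of N' e = v.
    by rewrite /head_of /N' /= !nth_set_nthE eqxx ifN //; lia.
  have hd_e1 : head_of N' e.+1 = u.
    by rewrite /head_of /N' /= nth_set_nthE eqxx.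
  have tl_e : tail_of N' e = u by rewrite /tail_of re; exact: hd_e1.
  have tl_e1 : tail_of N' e.+1 = v by rewrite /tail_of re1; exact: hd_e.
  (* [[seq x | _ <- nseq b 0]] is [[:: x]] or empty according to [b]; this form also covers [u = v]
     and yields the sizes at once. *)
  have arcs w : arcs_from N' w = [seq e.+1 | _ <- nseq (w == v) 0] ++
      [seq e | _ <- nseq (w == u) 0] ++ arcs_from N w.
    rewrite /arcs_from /N' /= !nth_set_nthE.
    case: (w =P v) => [->|_] /=; first by case: (v =P u) => [->|].
    by case: (w =P u) => [->|].
  split.
    move=> w x; rewrite arcs !mem_cat => /or3P[/mapP[y]|/mapP[y]|].
    + by rewrite mem_nseq; case: eqP => [-> _ ->|//]; rewrite tl_e1 hd_e1; split.
    + by rewrite mem_nseq; case: eqP => [-> _ ->|//]; rewrite tl_e hd_e; split.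
    + move=> /wf_arc[xe tx hx]; rewrite tail_old // head_old //; split=> //; lia.
  rewrite /=; under eq_bigr do rewrite arcs !size_cat !size_map !size_nseq.
  rewrite !big_split /=.
  exact: leq_add (sum_eq_le1 _ _) (leq_add (sum_eq_le1 _ _) wf_size).
- rewrite /source_cap big_mkcond /= !big_ord_recr /= -big_mkcond /=.
  have -> : cap_of N' e.+1 = 0 by rewrite /cap_of /N' /= nth_set_nthE eqxx.
  have -> : tail_of N' e = u.
    by rewrite /tail_of /rev_arc (negbTE ev) /= nth_set_nthE eqxx.
  have -> : cap_of N' e = c.
    by rewrite /cap_of /N' /= !nth_set_nthE eqxx ifN //; lia.
  rewrite if_same addn0 leq_add //; last by case: eqP; lia.
  rewrite [leqLHS](eq_bigl (fun x : 'I_e => tail_of N x == 0)); last first.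
    move=> x; congr (_ == _).
    have ltr := rev_arc_lt ev (ltn_ord x).
    by rewrite /tail_of /= !nth_set_nthE !ifN //; lia.
  apply: leq_sum => x _; rewrite /cap_of /= !nth_set_nthE !ifN //.
    by move: (ltn_ord x); lia.
  by move: (ltn_ord x); lia.
Qed.

Lemma ensures_empty_network nodes arcs :
  ensures (empty_network nodes arcs) (fun N t =>
    [/\ t = 4 * arcs + nodes + 4, num_nodes N = nodes, well_formed N 0 &
        source_cap N 0 0 = 0]).
Proof.
rewrite /empty_network; ops.
do 3![apply: ensures_bind;
  apply: ensures_weaken (ensures_array_new _ _) _ => _ _ [-> ->]].
apply: ensures_now; split=> //; first by lia.
  split=> /= [u e|]; first by rewrite /arcs_from /= nth_nseq if_same.
  by rewrite big1 // => u _; rewrite /arcs_from /= nth_nseq if_same.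
by rewrite /source_cap big_ord0.
Qed.

Section Network.
Context (X : Type) (m : nat).

(* [b] bounds the number of arcs added so far. *)
Definition building V b c (st : network * nat) : Prop :=
  [/\ ~~ odd st.2, st.2 <= 2 * b, num_nodes st.1 = V, well_formed st.1 st.2 &
      source_cap st.1 0 st.2 <= c].

Lemma building_le V b b' c c' st :
  b <= b' -> c <= c' -> building V b c st -> building V b' c' st.
Proof. by move=> bb' cc' [h1 h2 h3 h4 h5]; split=> //; lia. Qed.

Lemma building_add_arc V b c st u v c' :
  building V b c st -> u < V -> v < V ->
  ensures (add_arc st.1 st.2 u v c') (fun st' t =>
    t = 10 /\ building V b.+1 (c + (u == 0) * c') st').
Proof.
move=> [ev le_e EV wf sc] uV vV.
apply: ensures_weaken (ensures_add_arc c' ev wf _ _) _; rewrite ?EV //.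
move=> [N e] t /= [-> -> EV' wf' sc']; split=> //; split=> //=.
- by rewrite negbK.
- lia.
- by apply: leq_trans sc' _; rewrite leq_add2r.
Qed.

(** Only the first loop adds arcs leaving node 0, each of capacity 1, so the source capacity is at
    most the number of sets. [M] is the final arc counter; every arc takes two numbers. *)
Lemma ensures_build_network caps (Ns : seq (seq (option X))) c :
  size Ns = c ->
  ensures (build_network m caps Ns) (fun Nm t => exists M,
    [/\ t <= 50 * (c * m + c + m + 1), size Nm.2 <= c * m,
        M <= 2 * (c + c * m + m), num_nodes Nm.1 = c + m + 2 &
        well_formed Nm.1 M /\ source_cap Nm.1 0 M <= c]).
Proof.
move=> szN; rewrite /build_network.
apply: ensures_bind; apply: ensures_weaken (ensures_lengthM _) _ => c' t1 [Ec ht1].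
rewrite szN in Ec ht1; rewrite {c'}Ec; ops.
apply: ensures_bind.
apply: ensures_weaken (ensures_empty_network _ _) _ => N t2 [ht2 EV wf sc].
set V := c + m + 2 in EV ht2 *.
apply: ensures_bind.
apply: ensures_weaken (ensures_foreach_const (c := 11)
  (I := fun l st => [/\ all (fun a => a < c) l, size l <= c &
     building V (c - size l) (c - size l) st]) _ _) _.
- rewrite size_iota subnn; split=> //; first by apply/allP => a; rewrite mem_iota.
  by split=> //; rewrite sc.
- move=> a l st [/= /andP[ac lc] lec hb]; ops.
  apply: ensures_weaken (building_add_arc 1 hb _ _) _; rewrite ?/V; try lia.
  move=> st' t [-> hb']; split=> //; split=> //; first exact: ltnW.
  by apply: building_le hb'; lia.
move=> st0 t3 [[_ _ hb0] ht3]; rewrite size_iota /= subn0 in hb0 ht3.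
apply: ensures_bind.
apply: ensures_weaken (ensures_foreach_const (c := 13 * m + 4)
  (I := fun l st => [/\ st.2 + size l = c, size st.1.2 <= st.2 * m &
     building V (c + st.2 * m) c st.1.1]) _ _) _.
- by split; rewrite ?mul0n ?addn0 ?add0n.
- move=> T l [[Ne mids] a] /= [Ea szm hb]; ops.
  apply: ensures_bind.
  (* An empty table cell adds no arc, so the arc count is tracked by an existential upper bound
     [b]. *)
  apply: ensures_weaken (ensures_foreach_const (c := 12)
    (I := fun l st => [/\ all (fun j => j < m) l,
       size st.2 + size l <= a * m + m &
       exists2 b, b + size l <= c + a * m + m & building V b c st.1]) _ _) _.
  + split=> /=.
    * by apply/allP => j; rewrite mem_iota.
    * by rewrite size_iota; lia.
    * by exists (c + a * m) => //; rewrite size_iota.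
  + move=> j l' [[N' e] mids'] /= [/andP[jm lm] szm' [b hb1 hb2]]; ops.
    case: (nth None T j) => [x|]; last first.
      by apply: ensures_now; split=> //; split=> //=; [lia|exists b => //; lia].
    ops; apply: ensures_bind.
    apply: ensures_weaken (building_add_arc 1 hb2 _ _) _; rewrite ?/V; try lia.
    move=> st' t [-> hb']; apply: ensures_now; split=> //; split=> //=; first lia.
    by exists b.+1; [lia|rewrite addn0 in hb'].
  move=> [Ne' mids'] t [[_ szm' [b hb1 hb2]] ht]; rewrite size_iota in ht.
  ops; apply: ensures_now; split; last by lia.
  rewrite /= addn0 in hb1 szm' *; rewrite mulSn; split; [lia|lia|].
  by apply: building_le hb2; lia.
move=> [[Ne mids] a] t4 [/= [Ea szm hb] ht4]; rewrite addn0 in Ea; subst a.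
apply: ensures_bind.
apply: ensures_weaken (ensures_foreach_const (c := 12)
  (I := fun l st => [/\ all (fun j => j < m) l, size l <= m &
     building V (c + c * m + (m - size l)) c st]) _ _) _.
- rewrite size_iota subnn addn0; split=> //.
  by apply/allP => j; rewrite mem_iota.
- move=> j l st [/= /andP[jm lm] lem hb']; ops.
  apply: ensures_weaken (building_add_arc _ hb' _ _) _; rewrite ?/V; try lia.
  move=> st' t [-> hb2]; split=> //; split=> //; first exact: ltnW.
  by apply: building_le hb2; rewrite ?addn0 //; lia.
move=> [N' e] t5 [[_ _ [/= ev le_e EV' wf' sc']] ht5]; rewrite size_iota in ht5.
apply: ensures_now; exists e; split=> //=; last by rewrite subn0 in le_e.
by move: ht4; rewrite szN /V in ht2 *; lia.
Qed.
End Network.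

(** * Running times of processors and coordinator *)

Section AlgorithmTime.
Context (R : realFieldType) (X : Type) (d : X -> X -> R).
Context (m : nat) (g : X -> nat) (g_lt : forall x, g x < m).

Lemma ensures_representatives p rad l :
  ensures (representatives d m g p rad l) (fun T t =>
    size T = m /\ t <= m + 6 * size l + 4).
Proof.
rewrite /representatives.
apply: ensures_bind; apply: ensures_weaken (ensures_array_new _ _) _ => _ _ [-> ->].
ops.
apply: ensures_weaken (ensures_foreach_const (c := 5)
  (I := fun _ T => size T = m) _ _) _.
(* [set_nth] would lengthen the table if a group index reached [m]; [g_lt] excludes this. *)
- by rewrite size_set_nth size_nseq; apply/maxn_idPr.
- move=> x l' T szT; ops; case: ifP => _; last by apply: ensures_now.
  ops; case: (nth None T _) => [y|]; first by apply: ensures_now.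
  by apply: ensures_op; rewrite size_set_nth szT; split=> //; apply/maxn_idPr.
- by move=> T t [szT ht]; split=> //; lia.
Qed.

Lemma ensures_list_of_table (T : seq (option X)) :
  ensures (list_of_table T) (fun l t => size l <= size T /\ t <= size T + 1).
Proof.
elim: T => [|o T IH] /=; apply: ensures_later; first by apply: ensures_now.
apply: ensures_bind; apply: ensures_weaken IH _ => l t [szl ht].
by apply: ensures_now; split; [case: o => /=; lia|lia].
Qed.

Lemma ensures_farthest tie j dflt (D : seq (X * R)) :
  ensures (farthest tie j dflt D) (fun _ t => t <= 4 * size D + 1).
Proof.
apply: ensures_weaken (ensures_foreach_const (c := 3) (I := fun _ _ => True) _ _) _.
- by [].
- by move=> [x dx] l [b db] _; ops; apply: ensures_now.
- by move=> _ t [_]; rewrite size_behead; lia.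
Qed.

Lemma ensures_update_distances p (D : seq (X * R)) :
  ensures (update_distances d p D) (fun D' t =>
    size D' = size D /\ t <= 3 * size D + 1).
Proof.
apply: ensures_weaken (ensures_mapM (c := 2) (P := fun _ => True) D _) _.
- by move=> [x dx]; ops; apply: ensures_now.
- by move=> D' t [].
Qed.

Lemma ensures_select_farthest tie dflt c j (D : seq (X * R)) :
  ensures (select_farthest d tie dflt c j D) (fun sel t =>
    [/\ size sel.1 = c, size sel.2 = size D & t <= c * (7 * size D + 3) + 1]).
Proof.
elim: c j D => [|c IH] j D /=; apply: ensures_later; first by apply: ensures_now.
apply: ensures_bind; apply: ensures_weaken (ensures_farthest _ _ _ _) _ => pd t1 h1.
apply: ensures_bind.
apply: ensures_weaken (ensures_update_distances _ _) _ => D' t2 [szD h2].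
apply: ensures_bind; apply: ensures_weaken (IH _ _) _ => sel t3 [E1 E2].
rewrite szD in E2 *; move=> h3.
by apply: ensures_now; rewrite /= E1 E2; split=> //; lia.
Qed.

Lemma ensures_mapM_now (A B : Type) (f : A -> B) (l : seq A) :
  ensures (mapM (fun x => Now (f x)) l) (fun ys t =>
    ys = [seq f x | x <- l] /\ t = size l + 1).
Proof.
elim: l => [|x l IH] /=; apply: ensures_later; first by apply: ensures_now.
rewrite bind_now; apply: ensures_bind; apply: ensures_weaken IH _ => ys t [-> ->].
by apply: ensures_now; rewrite addn0.
Qed.

Lemma size_flatten_le (A : Type) (ls : seq (seq A)) b :
  List.Forall (fun l => size l <= b) ls -> size (flatten ls) <= size ls * b.
Proof. by elim=> [//|l ls' hl _ IH] /=; rewrite size_cat mulSn leq_add. Qed.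

(** Distances to the selected set are updated incrementally, so a selection round is linear in
    [size Xi], as is each of the [k] scans for representatives; each table adds a term linear in
    [m]. *)
Lemma ensures_processor k tie p1 (Xi : seq X) : 0 < k -> k <= size Xi -> 0 < m ->
  ensures (processor d m g k tie p1 Xi) (fun PL t =>
    [/\ size PL.1 = k, size PL.2 <= k * m & t <= 50 * (k * size Xi + k * m)]).
Proof.
move=> k0 kn m0; rewrite /processor; set n := size Xi in kn *.
apply: ensures_bind.
apply: ensures_weaken (ensures_mapM (c := 1) (P := fun _ => True) Xi _) _.
  by move=> x; ops; apply: ensures_now.
move=> D t1 [szD _ h1]; rewrite -/n in szD h1.
ops; apply: ensures_bind.
apply: ensures_weaken (ensures_select_farthest _ _ _ _ _) _.
move=> [ps D'] t2 /= [szps szD' h2]; rewrite szD in szD' h2.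
apply: ensures_bind; apply: ensures_weaken (ensures_farthest _ _ _ _) _ => fp t3 h3.
rewrite szD' in h3; ops; apply: ensures_bind; set rad := (2 * _)%R.
apply: ensures_weaken (ensures_mapM (p1 :: ps)
  (fun p => ensures_representatives p rad Xi)) _ => Ts t4 [szT hT h4].
have szP : size (p1 :: ps) = k by rewrite /= szps prednK.
rewrite szP in szT h4.
apply: ensures_bind.
(* The length bound [m] holds for the tables at hand only, hence an induction on [hT] in place of
   [ensures_mapM]. *)
apply: ensures_weaken (_ : ensures _ (fun ls t => [/\ size ls = size Ts,
  List.Forall (fun l : seq X => size l <= m) ls & t <= (m + 2) * size Ts + 1])) _.
  elim: {szT h4} hT => [|T Ts' ET _ IH] /=; apply: ensures_later.
    by apply: ensures_now; split; rewrite ?muln0.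
  apply: ensures_bind.
  apply: ensures_weaken (ensures_list_of_table _) _ => l t []; rewrite ET => szl ht.
  apply: ensures_bind; apply: ensures_weaken IH _ => ls t' [szls hls ht'].
  by apply: ensures_now; split; [rewrite /= szls|constructor|lia].
move=> ls t5 [szls hls h5]; rewrite szT in szls h5.
apply: ensures_bind; apply: ensures_weaken (ensures_flattenM _) _ => Li t6 [-> h6].
have szL := size_flatten_le hls; rewrite szls in szL h6.
apply: ensures_now; split=> //=.
have [kn0 km0] : k <= k * n /\ k <= k * m by rewrite !leq_pmulr //; lia.
have : k.-1 * (7 * n + 3) <= k * (7 * n + 3) by rewrite leq_mul2r leq_pred orbT.
have n_kn : n <= k * n by rewrite leq_pmull.
rewrite -/n in h4.
move: h1 h2 h3 h4 h5 h6 szL; lia.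
Qed.

(** The kept list is pairwise far at every moment of the scan, so the hypothesis bounds every inner
    loop as well as the result. *)
Lemma ensures_scattered k rad (l : seq X) :
  (forall P : seq X, pairwise (fun q p => (rad < d p q)%R) P -> size P <= k) ->
  ensures (scattered d rad l) (fun P t =>
    size P <= k /\ t <= (3 * k + 2) * size l + 1).
Proof.
move=> hP.
apply: ensures_weaken (ensures_foreach_const (c := 3 * k + 1)
  (I := fun _ P => pairwise (fun q p => (rad < d p q)%R) P) _ _) _ => //.
- move=> q l' P pw; apply: ensures_bind.
  (* While [far] holds, all points tested so far have passed, so testing all of [P] amounts to
     testing the rest, which is empty at the end. *)
  apply: ensures_weaken (ensures_foreach_const (c := 2)
    (I := fun l far => far = true ->
       all (fun p => (rad < d p q)%R) P = all (fun p => (rad < d p q)%R) l) _ _) _.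
  + by [].
  + move=> p l2 far I; ops; apply: ensures_now; split=> //.
    by move=> /andP[/I -> h] /=; rewrite h.
  move=> far t [I ht]; apply: ensures_now; split; last first.
    by have := hP _ pw; lia.
  by case: far I => // /(_ erefl) /= ->.
- by move=> P t [pw ht]; split; [exact: hP|rewrite -addnS in ht].
Qed.

Lemma ensures_selected_points N (mids : seq (nat * X)) :
  ensures (selected_points N mids) (fun _ t => t <= 4 * size mids + 1).
Proof.
apply: ensures_weaken (ensures_foreach_const (c := 3) (I := fun _ _ => True) _ _) _.
- by [].
- by move=> [e x] l S _; ops; apply: ensures_now.
- by move=> S t [].
Qed.

(** The dominant cost is at most [k] scans of [L], which has at most [k * m] points per message.
    Ford-Fulkerson contributes at most [k + 1] rounds, each linear in [k * m]. *)
Lemma ensures_coordinator k caps tau (messages : seq (seq X * seq X)) :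
  0 < k -> 0 < m -> 0 < size messages ->
  List.Forall (fun PL => size PL.1 = k /\ size PL.2 <= k * m) messages ->
  (forall P : seq X, pairwise (fun q p => (10 * tau < d p q)%R) P ->
     size P <= k) ->
  ensures (coordinator d m g caps tau messages) (fun _ t =>
    t <= 600 * (m * k ^ 2 * size messages)).
Proof.
move=> k0 m0 l0 hm hP; rewrite /coordinator; set l := size messages in l0 *.
apply: ensures_bind; apply: ensures_weaken (ensures_mapM_now _ _) _ => _ t1 [-> h1].
apply: ensures_bind; apply: ensures_weaken (ensures_mapM_now _ _) _ => _ t2 [-> h2].
apply: ensures_bind; apply: ensures_weaken (ensures_flattenM _) _ => _ t3 [-> h3].
apply: ensures_bind; apply: ensures_weaken (ensures_flattenM _) _ => _ t4 [-> h4].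
have szX : size (flatten [seq PL.1 | PL <- messages]) <= l * k.
  rewrite /l -(size_map (fun PL : seq X * seq X => PL.1)).
  apply: size_flatten_le; apply/List.Forall_map.
  by apply: List.Forall_impl hm => PL [-> _].
have szL : size (flatten [seq PL.2 | PL <- messages]) <= l * (k * m).
  rewrite /l -(size_map (fun PL : seq X * seq X => PL.2)).
  apply: size_flatten_le; apply/List.Forall_map.
  by apply: List.Forall_impl hm => PL [_].
rewrite !size_map -/l in h1 h2 h3 h4.
move: (flatten [seq PL.1 | PL <- messages]) (flatten [seq PL.2 | PL <- messages])
  szX szL h3 h4 => X' L szX szL h3 h4; ops.
apply: ensures_bind.
apply: ensures_weaken (ensures_scattered _ hP) _ => P t5 [szP h5].
apply: ensures_bind.
apply: ensures_weaken (ensures_mapM P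
  (fun q => ensures_representatives q (5 * tau)%R L)) _ => Ns t6 [szN _ h6].
apply: ensures_bind.
apply: ensures_weaken (ensures_build_network m caps szN) _.
move=> [N mids] t7 [M [h7 /= szm hM EV [wf sc]]].
apply: ensures_bind.
have sV : 0 < num_nodes N by rewrite EV addn2.
apply: ensures_weaken (ensures_ford_fulkerson (t := 1) wf sV _ sc) _ => // N' t8 h8.
apply: ensures_weaken (ensures_selected_points _ _) _ => S t9 h9.
set c := size P in szP szm h6 h7 h8 hM EV sc; rewrite EV in h8.
(* [Z] is the target and [a] the network size up to a constant. The inequalities below relate the
   products, which [lia] then treats as atoms. *)
pose a := k * m; pose Z := k * a * l.
have -> : m * k ^ 2 * l = Z by rewrite /Z /a; lia.
have k_a : k <= a by rewrite leq_pmulr.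
have m_a : m <= a by rewrite leq_pmull.
have ka_Z : k * a <= Z by rewrite leq_pmulr.
have a_ka : a <= k * a by rewrite leq_pmull.
have la_Z : l * a <= Z by rewrite /Z -mulnA (mulnC a) leq_pmull.
have a_la : a <= l * a by rewrite leq_pmull.
have cm_a : c * m <= a by rewrite leq_mul2r szP orbT.
have lk_la : l * k <= l * a by rewrite leq_mul2l k_a orbT.
have l_lk : l <= l * k by rewrite leq_pmulr.
have h5' : t5 <= 5 * Z + 1.
  apply: leq_trans h5 _; rewrite leq_add2r.
  apply: leq_trans (leq_mul (_ : _ <= 5 * k) szX) _; first by lia.
  have : k * (l * k) <= k * (l * a) by rewrite leq_mul2l lk_la orbT.
  by rewrite /Z; lia.
have h6' : t6 <= 12 * Z + 1.
  apply: leq_trans h6 _; rewrite leq_add2r mulnC.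
  apply: leq_trans (leq_mul szP (_ : _ <= 12 * (l * a))) _; last by rewrite /Z; lia.
  by move: szL; rewrite -/a; lia.
have h8' : t8 <= 272 * Z + 1.
  apply: leq_trans h8 _; rewrite leq_add2r.
  (* Each of [c], [m], [c * m] and 1 is at most [a], which gives 21 * 4 + 7 * 6 + 10 = 136. *)
  apply: leq_trans (leq_mul (_ : _ <= 2 * k) (_ : _ <= 136 * a)) _; try lia.
rewrite -/a in szL; clearbody Z a c l; lia.
Qed.

End AlgorithmTime.

(** * Scattered points and the optimum *)

Section Scattering.
Context (R : realType).

(** The empty minimum is [+oo], above every real, so a real bound is met at some index. *)
Lemma bigmin_le_ex (I : finType) (P : pred I) (F : I -> \bar R) (r : R) :
  (\big[Order.min/+oo]_(i | P i) F i <= r%:E)%E ->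
  exists2 i, P i & (F i <= r%:E)%E.
Proof.
apply: (big_ind (fun x => (x <= r%:E)%E -> _)) => [//|x y hx hy|i Pi Fi].
  by rewrite ge_min => /orP[/hx|/hy].
by exists i.
Qed.

Context (X : finType) (d : X -> X -> R) (m : nat) (g : X -> 'I_m).
Context (kc : 'I_m -> nat).

Lemma card_feasible S : feasible g kc S -> #|S| <= \sum_j kc j.
Proof.
move=> /forallP fS; rewrite -sum1_card (partition_big g predT) //=.
apply: leq_sum => j _; apply: leq_trans (fS j).
by rewrite -sum1_card; apply: eq_leq; apply: eq_bigl => x; rewrite inE.
Qed.

Lemma centers_exist tau : (OPT d g kc <= tau%:E)%E ->
  exists (S : {set X}) (f : X -> X), #|S| <= \sum_j kc j /\
    forall x, f x \in S /\ (d (f x) x <= tau)%R.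
Proof.
move=> /bigmin_le_ex[S fS]; rewrite /clustering_cost => /bigmax_leP[_ hS].
exists S; have hf x : exists a, a \in S /\ (d a x <= tau)%R.
  by have [//|a aS] := bigmin_le_ex (hS x _); rewrite ?inE // lee_fin; exists a.
by have [f hf'] := fin_all_exists hf; exists f; split=> //; apply: card_feasible.
Qed.

Lemma scattered_size tau (P : seq X) : is_metric d -> (OPT d g kc <= tau%:E)%E ->
  pairwise (fun q p => (10 * tau < d p q)%R) P -> size P <= \sum_j kc j.
Proof.
move=> [d0 _ dC dT] /centers_exist[S [f [szS hf]]] pw.
apply: leq_trans szS; rewrite -(size_map f) cardE.
apply: uniq_leq_size => [|y /mapP[x _ ->]]; last by rewrite mem_enum; case: (hf x).
rewrite uniq_pairwise pairwise_map; apply: sub_pairwise pw => q p /= far.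
apply/eqP => Ef; have [_ hq] := hf q; have [_ hp] := hf p.
have := dT p (f p) q; rewrite (dC p (f p)) -{2}Ef.
(* A common center gives [d p q <= 2 * tau]. A nonnegative distance of at most [tau] gives
   [0 <= tau], so this contradicts [10 * tau < d p q]. *)
by have := d0 (f p) p; lra.
Qed.

End Scattering.

(** * Total running time and the choice of the number of processors *)

Lemma running_time_exists (R : realType) (E : execution R) :
  exists2 T, running_time E T & exists2 q, q * processors E = #|points E| &
    [/\ T <= 650 * (total_capacity E * q +
          groups E * total_capacity E ^ 2 * processors E),
        0 < total_capacity E, 0 < groups E & 0 < #|points E|].
Proof.
set k := total_capacity E; set l := processors E; set m := groups E.
(* [q] is the common size of the parts and stands for the quotient of [n] by [l] in the natural
   numbers. *)
pose i0 : 'I_l := Ordinal (processors_gt0 E); pose q := size (part i0).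
have szq (i : 'I_l) : size (part i) = q.
  have /eqP := etrans (part_equal i) (esym (part_equal i0)).
  by rewrite eqn_pmul2r ?processors_gt0 // => /eqP.
have small (P : seq (points E)) :
    pairwise (fun q p => (10 * threshold E < dist p q)%R) P -> size P <= k.
  exact: scattered_size (dist_metric E) (threshold_ge_OPT E).
(* A one-point list is vacuously scattered, so its size 1 is at most [k]. *)
have k0 : 0 < k by apply: (small [:: first_point i0]).
have m0 : 0 < m by apply: leq_ltn_trans (ltn_ord (group (first_point i0))).
have kq : k < q by have := part_large i0; rewrite -/q addn1.
have hproc (i : 'I_l) : exists mt : (seq (points E) * seq (points E)) * nat,
    [/\ takes (processor_program i) mt.1 mt.2, size mt.1.1 = k,
        size mt.1.2 <= k * m & mt.2 <= 50 * (k * q + k * m)].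
  have gm x : val (group x) < m := ltn_ord (group x).
  have [|//|a [t [ht [h1 h2 h3]]]] := ensures_processor (@dist R E) gm
    (tie_break i) (first_point i) k0 (Xi := part i).
    by rewrite szq ltnW.
  by exists (a, t); rewrite szq in h3; split.
have [mt hmt] := fin_all_exists hproc.
pose messages i := (mt i).1.
have := @ensures_coordinator R _ (@dist R E) m (fun x => val (group x))
  (fun x => ltn_ord (group x)) k [seq capacity j | j <- enum 'I_(groups E)]
  (threshold E) [seq messages i | i <- enum 'I_(processors E)] k0 m0.
rewrite size_map size_enum_ord => /(_ (processors_gt0 E)) [||S [tc [htc hS]]] //.
  apply/List.Forall_map; elim: (enum _) => [|i s IH]; constructor=> //.
  by case: (hmt i).
exists (\max_i (mt i).2 + tc).
  exists messages, (fun i => (mt i).2), S, tc; split=> // i.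
  by case: (hmt i).
exists q; first exact: part_equal.
split=> //; last by apply/card_gt0P; exists (first_point i0).
have hmax : \max_i (mt i).2 <= 50 * (k * q + k * m).
  by apply/bigmax_leqP => i _; case: (hmt i).
(* The processor term [k * m] is absorbed by the coordinator term, whence 650 = 50 + 600. *)
have : k * m <= m * k ^ 2 * l.
  rewrite mulnC -mulnA leq_mul2l expnS expn1 -mulnA leq_pmulr ?orbT //.
  by rewrite muln_gt0 k0 processors_gt0.
by rewrite -/l in hS; lia.
Qed.

Local Open Scope ring_scope.

Theorem theorem3 (R : realType) :
  (exists C : R, forall E : execution R,
    let n := #|points E|%:R : R in
    let m := (groups E)%:R : R in
    let k := (total_capacity E)%:R : R in
    let l := (processors E)%:R : R in
    exists2 T : nat, running_time E T &
      T%:R <= C * (k * n / l + m * k ^+ 2 * l))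
  /\
  (forall c1 c2 : R, 0 < c1 -> 0 < c2 ->
    exists C : R, forall E : execution R,
    let n := #|points E|%:R : R in
    let m := (groups E)%:R : R in
    let k := (total_capacity E)%:R : R in
    let l := (processors E)%:R : R in
    c1 * Num.sqrt (n / (m * k)) <= l ->
    l <= c2 * Num.sqrt (n / (m * k)) ->
    exists2 T : nat, running_time E T &
      T%:R <= C * (m `^ (1 / 2) * k `^ (3 / 2) * n `^ (1 / 2))).
Proof.
have bound (E : execution R) : exists2 T, running_time E T &
    T%:R <= 650 * ((total_capacity E)%:R * #|points E|%:R / (processors E)%:R +
      (groups E)%:R * (total_capacity E)%:R ^+ 2 * (processors E)%:R) :> R.
  have [T hT [q Eq [le_T _ _ _]]] := running_time_exists E; exists T => //.
  have l0 : (processors E)%:R != 0 :> R by rewrite pnatr_eq0 -lt0n processors_gt0.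
  (* With [n = q * l] the real quotient is exact, and the claim is the cast of the bound on
     naturals. *)
  by rewrite -Eq natrM mulrA mulfK // -natrX -!natrM -natrD -natrM ler_nat.
split; first by exists 650.
(* The lower bound on [l] controls [k * n / l] and contributes [c1^-1]; the upper bound controls
   [m * k ^+ 2 * l] and contributes [c2]. *)
move=> c1 c2 c1_gt0 c2_gt0; exists (650 * (c1^-1 + c2)) => E n m k l l_ge l_le.
have [T hT le_T] := bound E; exists T => //; apply: le_trans le_T _.
rewrite -/n -/m -/k -/l -(mulrA 650) ler_pM2l //.
have [_ _ [_ _ [_ k_gt0 m_gt0 n_gt0]]] := running_time_exists E.
have sqrt_gt0 a : (0 < a)%N -> 0 < Num.sqrt a%:R :> R.
  by move=> a_gt0; rewrite sqrtr_gt0 ltr0n.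
have sqr_sqrt a : Num.sqrt a%:R ^+ 2 = a%:R :> R by rewrite sqr_sqrtr.
(* In terms of the positive square roots [x], [y], [z] all fractional powers become rational
   expressions, which [field] can compare. *)
pose x : R := Num.sqrt n; pose y : R := Num.sqrt m; pose z : R := Num.sqrt k.
have x0 : 0 < x by apply: sqrt_gt0.
have y0 : 0 < y by apply: sqrt_gt0.
have z0 : 0 < z by apply: sqrt_gt0.
have En : n = x ^+ 2 by rewrite /x sqr_sqrt.
have Em : m = y ^+ 2 by rewrite /y sqr_sqrt.
have Ek : k = z ^+ 2 by rewrite /z sqr_sqrt.
have Es : Num.sqrt (n / (m * k)) = x / (y * z).
  rewrite En Em Ek -exprMn -expr_div_n sqrtr_sqr ger0_norm //.
  by rewrite divr_ge0 ?mulr_ge0 ?ltW.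
have -> : m `^ (1 / 2) * k `^ (3 / 2) * n `^ (1 / 2) = y * z ^+ 3 * x.
  rewrite mul1r (mulrC 3) powRrM powR_mulrn ?powR_ge0 //.
  by rewrite !powR12_sqrt ?ler0n.
rewrite {}Es in l_ge l_le; rewrite En Em Ek mulrDl; apply: lerD.
  rewrite ler_pdivrMr; last by rewrite ltr0n processors_gt0.
  have -> : z ^+ 2 * x ^+ 2 = (c1^-1 * (y * z ^+ 3 * x)) * (c1 * (x / (y * z))).
    by field; rewrite !gt_eqF.
  by rewrite ler_pM2l // !mulr_gt0 ?invr_gt0 ?exprn_gt0.
have -> : c2 * (y * z ^+ 3 * x) = y ^+ 2 * z ^+ 2 ^+ 2 * (c2 * (x / (y * z))).
  by field; rewrite !gt_eqF.
by rewrite ler_pM2l // mulr_gt0 ?exprn_gt0.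
Qed.
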